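(* Let $H$ be a complex Hilbert space and let $\{x_j\}_{j\in\mathbb{N}}\subset H$ be a Bessel sequence with Bessel bound $1$. Then there exist complex-valued functions $\{f_j\}_{j\in\mathbb{N}}\subseteq L^\infty([0,1])$ with $\|f_j\|_{L^\infty([0,1])}\le 1$ for all $j\in\mathbb{N}$ and a constant $0<K<\infty$ such that $$\langle x_j,x_k\rangle = K\int_0^1 f_j(x)\overline{f_k(x)}\,dx,\qquad j,k\in\mathbb{N}.$$ Moreover, one can choose $K=1$, and this constant is optimal: $K=1$ is the smallest constant $K$ such that for every complex Hilbert space $H$ and every Bessel sequence $\{x_j\}_{j\in\mathbb{N}}\subset H$ with Bessel bound $1$ there exist complex-valued functions $\{f_j\}_{j\in\mathbb{N}}\subseteq L^\infty([0,1])$ with $\|f_j\|_{L^\infty([0,1])}\le 1$ for all $j\in\mathbb{N}$ satisfying $\langle x_j,x_k\rangle = K\int_0^1 f_j(x)\overline{f_k(x)}\,dx$ for all $j,k\in\mathbb{N}$.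
   Context: Inner products are linear in the first variable and conjugate-linear in the second. A sequence $\{x_j\}_{j\in\mathbb{N}}$ in a complex Hilbert space is called a Bessel sequence with Bessel bound $1$ if for every $N\in\mathbb{N}$ and all $c_1,\dots,c_N\in\mathbb{C}$ one has $$\Big\|\sum_{j=1}^N c_jx_j\Big\|^2\le\sum_{j=1}^N|c_j|^2.$$ The space $L^\infty([0,1])$ is taken with respect to Lebesgue measure and consists of complex-valued functions. *)

(* Defs.v *)
From HB Require Import structures.
From mathcomp Require Import all_boot all_order all_algebra.
From mathcomp Require Export complex.
From mathcomp Require Import all_classical all_reals all_analysis.

Set Implicit Arguments.
Unset Strict Implicit.
Unset Printing Implicit Defensive.

Import Order.TTheory GRing.Theory Num.Theory.
Import numFieldNormedType.Exports.

Local Open Scope classical_set_scope.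
Local Open Scope ring_scope.
Local Open Scope complex_scope.

(* [{dot H for Num.conj}] is linear in its first argument, conjugate-linear in the
   second, Hermitian and positive definite. *)
Record complexHilbert (R : realType) := ComplexHilbert {
  hilbert_sort :> completeNormedModType R[i] ;
  inner : {dot hilbert_sort for @Num.conj R[i]} ;
  sqr_norm_inner : forall u : hilbert_sort, `|u| ^+ 2 = inner u u
}.
Arguments inner {R c}.

(* The inequality lives in [R[i]], where [a <= b] means that [b - a] is a
   nonnegative real; norms take values in the nonnegative reals of [R[i]]. *)
Definition bessel1 (R : realType) (H : complexHilbert R) (x : nat -> H) : Prop :=
  forall (N : nat) (c : 'I_N -> R[i]),
    `|\sum_(j < N) c j *: x j| ^+ 2 <= \sum_(j < N) `|c j| ^+ 2.

Section UnitInterval.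
Variable R : realType.
Implicit Type f : R -> R[i].

Definition I01 : set R := `[0, 1].

Lemma measurable_I01 : measurable I01.
Proof. exact: measurable_itv. Qed.

Definition lebesgue01 : {measure set (measurableTypeR R) -> \bar R} :=
  mrestr (@lebesgue_measure R) measurable_I01.

(* Borel measurability loses nothing: every class of L^oo([0,1]) has a
   Borel representative. Values outside [I01] play no role. *)
Definition cmeasurable01 f : Prop :=
  measurable_fun I01 (fun t => complex.Re (f t)) /\
  measurable_fun I01 (fun t => complex.Im (f t)).

Definition Linfty_norm f : \bar R :=
  ('N[lebesgue01]_+oo[(fun t => (Normc.normc (f t))%:E)])%E.

Definition in_Linfty01 f : Prop := cmeasurable01 f /\ (Linfty_norm f < +oo)%E.

Definition cintegral01 f : R[i] :=
  (\int[lebesgue_measure]_(t in I01) complex.Re (f t)) +i*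
  (\int[lebesgue_measure]_(t in I01) complex.Im (f t)).

End UnitInterval.

Definition gram_rep (R : realType) (H : complexHilbert R) (x : nat -> H)
    (f : nat -> R -> R[i]) (K : R) : Prop :=
  [/\ forall j, in_Linfty01 (f j),
      forall j, (Linfty_norm (f j) <= 1)%E &
      forall j k, inner (x j) (x k) =
        K%:C * cintegral01 (fun t => f j t * (f k t)^*%R)].

Definition universal_const (R : realType) (K : R) : Prop :=
  forall (H : complexHilbert R) (x : nat -> H), bessel1 x ->
    exists f : nat -> R -> R[i], gram_rep x f K.

(* Main.v *)
Require Import Defs.
From HB Require Import structures.
From mathcomp Require Import all_boot all_order all_algebra.
From mathcomp Require Import all_classical all_reals all_analysis.
From mathcomp Require Import measurable_realfun ess_sup_inf ring lra.

(**
The Gram matrix G of a Bessel sequence with bound 1 satisfies 0 <= G <= 1.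
A family f_j with values in the closed unit disc D and
int_0^1 f_j conj(f_k) = G_jk is the same thing as a random vector z in D^N,
defined on the probability space [0,1], with second moments E z_j conj(z_k) =
G_jk. So everything rests on realizing 0 <= G <= 1 by such a random vector.

The finite-dimensional core is a statement about one Hermitian n x n matrix A:
the supremum h(A) of <Az,z> over z in D^n is at least tr A_+, the sum of the
positive eigenvalues of A ([polydisc_sup_ge_pospart]). Indeed, a maximizer z of
<(A - t)z,z> has at least as many coordinates of modulus 1 as A has eigenvalues
above t: otherwise some w <> 0 in the span of the eigenvectors for these
eigenvalues vanishes at all coordinates of modulus 1, so that z + w and z - w
stay in D^n once w is small, and by the parallelogram identity one of them does
better than z. Hence |z|^2 is at least that number of eigenvalues, and since
<Az,z> = <(A - t)z,z> + t|z|^2, letting t run down from the largest eigenvalue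
to 0 makes h(A - t) grow at least as fast as tr (A - t)_+. The proof below works
with near-maximizers and with finitely many steps, one for each positive
eigenvalue.

As tr(AG) <= tr A_+ when 0 <= G <= 1 ([trace_gram_le]), for every Hermitian A
some z in D^n has <Az,z> >= tr(AG) - 1. Choosing z_1, z_2, ... greedily, each
time with A the accumulated residual sum_i (G - z_i z_i^* ), keeps the squared
Hilbert-Schmidt norm of the residual of linear growth in the number k of points,
so the uniform average of the z_i z_i^* approaches G at rate k^(-1/2)
([gram_approximation]).

It remains to pass to the limit in the number of points and in n. All real and
imaginary parts of a point are written in signed binary digits and the digits
interleaved into one 0-1 sequence. Along an ultrafilter the frequency of every
finite word converges; the limits form a probability on the binary tree, which
is laid out on [0,1[ by nested intervals whose lengths are the limit masses.
Reading digits off these intervals gives the functions ([limit_law]). Digit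
truncations converge uniformly, so integrals of products pass to the limit, and
a point of [0,1[ meets only words of positive mass, that is, words of actual
points of D^n, whence the bound by 1.

The constant 1 cannot be lowered because of a single unit vector x_0, for which
1 = K int |f_0|^2 <= K ([universal_const_ge1]).
*)

Set Implicit Arguments.
Unset Strict Implicit.
Unset Printing Implicit Defensive.

Import Order.TTheory GRing.Theory Num.Theory.
Import numFieldNormedType.Exports.

Local Open Scope classical_set_scope.
Local Open Scope ring_scope.

(** * Quadratic forms on the polydisc *)

Section QuadraticForms.
Local Open Scope complex_scope.
Local Open Scope sesquilinear_scope.
Variable R : realType.
Local Notation C := R[i].

(** The square of the modulus as an element of [R]: the norm of [R[i]] takes values
in [R[i]], whose order is only partial, and suprema are needed. *)
Definition sqn (z : C) : R := complex.Re z ^+ 2 + complex.Im z ^+ 2.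

Lemma sqnE z : (sqn z)%:C = z * (z^* )%R.
Proof. by rewrite /sqn add_Re2_Im2 normCK. Qed.

Lemma sqn_ge0 z : 0 <= sqn z.
Proof. by rewrite addr_ge0 ?sqr_ge0. Qed.

Lemma sqn0 : sqn 0 = 0.
Proof. by rewrite /sqn /= expr0n /= addr0. Qed.

Lemma sqn_eq0 z : (sqn z == 0) = (z == 0).
Proof.
rewrite /sqn paddr_eq0 ?sqr_ge0 // !sqrf_eq0.
by case: z => a b /=; rewrite eq_complex.
Qed.

Lemma sqn_real (a : R) z : sqn (a%:C * z) = a ^+ 2 * sqn z.
Proof. by case: z => x y; rewrite /sqn /=; ring. Qed.

Lemma sqn_parallelogram z w : sqn (z + w) + sqn (z - w) = 2 * sqn z + 2 * sqn w.
Proof. by case: z => a b; case: w => c d; rewrite /sqn /=; ring. Qed.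

Lemma sqnN z : sqn (- z) = sqn z.
Proof. by case: z => a b; rewrite /sqn /= !sqrrN. Qed.

Lemma sqn_add_le (p q : R) z w : 0 <= p -> 0 <= q ->
  sqn z <= p ^+ 2 -> sqn w <= q ^+ 2 -> sqn (z + w) <= (p + q) ^+ 2.
Proof.
case: z w => [a b] [c d] p0 q0; rewrite /sqn /= => zp wq.
suff : a * c + b * d <= p * q by nra.
apply: le_trans (ler_norm _) _; rewrite -(@ler_pXn2r _ 2) ?nnegrE ?mulr_ge0 //.
rewrite real_normK ?num_real // exprMn.
apply: (@le_trans _ _ ((a ^+ 2 + b ^+ 2) * (c ^+ 2 + d ^+ 2))).
  by rewrite -subr_ge0 [leRHS](_ : _ = (a * d - b * c) ^+ 2) ?sqr_ge0 //; ring.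
by apply: ler_pM => //; rewrite addr_ge0 ?sqr_ge0.
Qed.

Lemma sqnM (a b : C) : sqn (a * b) = sqn a * sqn b.
Proof. by case: a => a1 a2; case: b => b1 b2; rewrite /sqn /=; ring. Qed.

Lemma sqnJ (a : C) : sqn (a^* )%R = sqn a.
Proof. by case: a => a1 a2; rewrite /sqn /=; ring. Qed.

Lemma sqnD (a b : C) : sqn (a + b) = sqn a + sqn b + 2 * complex.Re (a^* * b)%R.
Proof. by case: a => a1 a2; case: b => b1 b2; rewrite /sqn /=; ring. Qed.

Lemma normc_sqn (z : C) : Normc.normc z = Num.sqrt (sqn z).
Proof. by case: z. Qed.

Lemma ReZ (c : R) (z : C) : complex.Re (c%:C * z) = c * complex.Re z.
Proof. by case: z => a b /=; rewrite mul0r subr0. Qed.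

Lemma ImZ (c : R) (z : C) : complex.Im (c%:C * z) = c * complex.Im z.
Proof. by case: z => a b /=; rewrite mul0r addr0. Qed.

Lemma sqn_le_ReIm (d : R) (z : C) : 0 <= d -> sqn z <= d ^+ 2 ->
  `|complex.Re z| <= d /\ `|complex.Im z| <= d.
Proof.
case: z => a b d0; rewrite /sqn /= => abd; rewrite !ler_norml.
by split; apply/andP; split; nra.
Qed.

Variable n : nat.
Implicit Types (z w : 'rV[C]_n) (V : 'M[C]_n) (d : 'I_n -> R).

Definition rnorm2 z : R := \sum_j sqn (z 0 j).

(** For unitary [V], the Hermitian form with eigenvalues [d] in the orthonormal basis
that [V] defines. *)
Definition diagform d V z : R := \sum_i d i * sqn ((z *m V) 0 i).

Definition in_polydisc z : Prop := forall j, sqn (z 0 j) <= 1.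

Lemma rnorm2E z : (rnorm2 z)%:C = (z *m z ^t*) 0 0.
Proof.
rewrite /rnorm2 rmorph_sum /= mxE; apply: eq_bigr => j _.
by rewrite sqnE !mxE.
Qed.

Lemma rnorm2_unitary V z : V \is unitarymx -> rnorm2 (z *m V) = rnorm2 z.
Proof.
move=> /unitarymxP VV; apply: (@complexI R); rewrite !rnorm2E.
by rewrite trmx_mul map_mxM /= mulmxA -(mulmxA z) VV mulmx1.
Qed.

Lemma rnorm2_ge0 z : 0 <= rnorm2 z.
Proof. by apply: sumr_ge0 => j _; exact: sqn_ge0. Qed.

Lemma rnorm2_gt0 z : z != 0 -> 0 < rnorm2 z.
Proof.
move=> z0; rewrite lt_def rnorm2_ge0 andbT; apply: contra z0.
rewrite psumr_eq0 => [/allP z0|j _]; last exact: sqn_ge0.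
apply/eqP/rowP => j; rewrite mxE; apply/eqP; rewrite -sqn_eq0.
by have := z0 j; rewrite mem_index_enum => /(_ isT).
Qed.

Lemma sqn_le_rnorm2 z j : sqn (z 0 j) <= rnorm2 z.
Proof.
rewrite /rnorm2 (bigD1 j) //= lerDl.
by apply: sumr_ge0 => i _; exact: sqn_ge0.
Qed.

Lemma diagform_shift d V z t : V \is unitarymx ->
  diagform (fun i => d i - t) V z = diagform d V z - t * rnorm2 z.
Proof.
move=> /rnorm2_unitary <-; rewrite /diagform /rnorm2 mulr_sumr -sumrB.
by apply: eq_bigr => i _; rewrite mulrBl.
Qed.

Lemma diagform_parallelogram d V z w :
  diagform d V (z + w) + diagform d V (z - w) =
  2 * diagform d V z + 2 * diagform d V w.
Proof.
rewrite /diagform -!big_split !mulr_sumr -big_split /=; apply: eq_bigr => i _.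
rewrite mulmxDl mulmxBl; move: (z *m V) (w *m V) => zV wV; rewrite !mxE.
rewrite -mulrDr sqn_parallelogram; ring.
Qed.

Lemma rnorm2Z (a : R) z : rnorm2 (a%:C *: z) = a ^+ 2 * rnorm2 z.
Proof.
by rewrite /rnorm2 mulr_sumr; apply: eq_bigr => j _; rewrite mxE sqn_real.
Qed.

Lemma le_diagform d d' V z : (forall i, d i <= d' i) ->
  diagform d V z <= diagform d' V z.
Proof. by move=> dd'; apply: ler_sum => i _; rewrite ler_wpM2r ?sqn_ge0. Qed.

Definition polydisc_sup d V : R :=
  sup [set r | exists2 z, in_polydisc z & r = diagform d V z]%classic.

Lemma polydisc0 : in_polydisc 0.
Proof. by move=> j; rewrite mxE sqn0. Qed.

Lemma rnorm2_polydisc z : in_polydisc z -> rnorm2 z <= n%:R.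
Proof.
move=> zD; rewrite -[n in n%:R]card_ord -sum1_card natr_sum.
by apply: ler_sum => j _; exact: zD.
Qed.

Lemma has_sup_polydisc d V : V \is unitarymx ->
  has_sup [set r | exists2 z, in_polydisc z & r = diagform d V z]%classic.
Proof.
move=> VU; split; first by exists (diagform d V 0), 0 => //; exact: polydisc0.
exists (\sum_i `|d i| * n%:R) => _ [z zD ->].
apply: ler_sum => i _; apply: (le_trans (ler_norm _)).
rewrite normrM (ger0_norm (sqn_ge0 _)) ler_wpM2l //.
apply: le_trans (sqn_le_rnorm2 _ i) _.
by rewrite rnorm2_unitary //; exact: rnorm2_polydisc.
Qed.

Lemma polydisc_sup_ge d V z : V \is unitarymx -> in_polydisc z ->
  diagform d V z <= polydisc_sup d V.
Proof.
move=> VU zD; apply: ub_le_sup; last by exists z.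
by case: (has_sup_polydisc d VU).
Qed.

Lemma polydisc_sup_approx d V e : V \is unitarymx -> 0 < e ->
  exists2 z, in_polydisc z & polydisc_sup d V - e < diagform d V z.
Proof.
move=> VU e0; have [_ [z zD ->] ?] := sup_adherent e0 (has_sup_polydisc d VU).
by exists z.
Qed.

Lemma le_polydisc_sup d d' V : V \is unitarymx -> (forall i, d i <= d' i) ->
  polydisc_sup d V <= polydisc_sup d' V.
Proof.
move=> VU dd'; apply: ge_sup => [|_ [z zD ->]].
  by case: (has_sup_polydisc d VU).
exact: le_trans (le_diagform _ _ dd') (polydisc_sup_ge _ VU zD).
Qed.

(** A dimension count: the conditions on [w] are [#|J| + (n - #|I|) < n] linear
equations. *)
Lemma exists_vanishing_row V (I J : pred 'I_n) : (#|J| < #|I|)%N ->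
  exists w : 'rV[C]_n, [/\ w != 0, forall j, J j -> w 0 j = 0 &
    forall i, ~~ I i -> (w *m V) 0 i = 0].
Proof.
move=> JI.
pose A : 'M[C]_(n, #|predC I|) := \matrix_(i, k) V i (enum_val k).
pose B : 'M[C]_(n, #|J|) := \matrix_(i, k) (i == enum_val k)%:R.
pose M := row_mx A B.
have rM : (\rank M < n)%N.
  apply: leq_ltn_trans (rank_leq_col M) _.
  rewrite -[X in (_ < X)%N](card_ord n) -(cardC I) addnC.
  by rewrite ltn_add2r.
have : kermx M != 0 by rewrite kermx_eq0 neq_ltn rM.
case/rowV0Pn => w /sub_kermxP wM w0; exists w; split => //.
- move: wM; rewrite mul_mx_row => /(congr1 rsubmx); rewrite row_mxKr linear0 => wB j Jj.
  have := congr1 (fun M : 'rV_ _ => M 0 (enum_rank_in Jj j)) wB; rewrite !mxE.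
  rewrite (bigD1 j) //= !mxE enum_rankK_in // eqxx mulr1 big1 ?addr0 // => i ij.
  by rewrite mxE enum_rankK_in // (negbTE ij) mulr0.
- move: wM; rewrite mul_mx_row => /(congr1 lsubmx); rewrite row_mxKl linear0 => wA i Ii.
  have Ii' : i \in predC I by [].
  have := congr1 (fun M : 'rV_ _ => M 0 (enum_rank_in Ii' i)) wA; rewrite !mxE => wA0.
  by rewrite -[RHS]wA0; apply: eq_bigr => k _; rewrite mxE enum_rankK_in.
Qed.

(** Near-maximizers of the form with eigenvalues [d i - t] have at least [m]
coordinates of modulus above [1 - th]. If not, a row [w] of norm [th] supported
on the remaining coordinates and on the eigenvectors with [b <= d i] can be both
added and subtracted inside the polydisc, and the form gains at least
[(b - t) * th ^+ 2] on average. Restoring the shift [t] then adds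
[t * rnorm2 z >= t * (m * (1 - th) ^+ 2)]. *)
Lemma polydisc_sup_drop d V (b t th : R) (m := #|[pred i | b <= d i]|) :
  V \is unitarymx -> 0 < t -> t < b -> 0 < th -> th < 1 ->
  polydisc_sup (fun i => d i - b) V + t * (m%:R * (1 - th) ^+ 2)
    - (b - t) * th ^+ 2 <= polydisc_sup d V.
Proof.
move=> VU t0 tb th0 th1.
pose dt i := d i - t.
have eta0 : 0 < (b - t) * th ^+ 2 by rewrite mulr_gt0 ?exprn_gt0 ?subr_gt0.
have [z zD zmax] := polydisc_sup_approx dt VU eta0.
pose J := [pred j | (1 - th) ^+ 2 < sqn (z 0 j)].
have mJ : (m <= #|J|)%N.
  rewrite leqNgt; apply/negP => /(exists_vanishing_row V)[w0 [w0n0 w0J w0I]].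
  have r0 := rnorm2_gt0 w0n0.
  (* Scaled to norm th, so that every entry of w has modulus at most th. *)
  pose a := th / Num.sqrt (rnorm2 w0).
  pose w := a%:C *: w0.
  have rw : rnorm2 w = th ^+ 2.
    by rewrite rnorm2Z exprMn exprVn sqr_sqrtr ?ltW // divfK // gt_eqF.
  have wI i : ~~ (b <= d i) -> (w *m V) 0 i = 0.
    by move=> di; rewrite -scalemxAl mxE w0I // mulr0.
  have wD (e : bool) : in_polydisc (z + (-1) ^+ e *: w).
    move=> j; have [Jj|Jj] := boolP (J j).
      by rewrite !mxE w0J // !mulr0 addr0.
    apply: (@le_trans _ _ ((1 - th + th) ^+ 2)); last by rewrite subrK expr1n.
    rewrite !mxE.
    apply: sqn_add_le; [by rewrite subr_ge0 ltW|exact: ltW|by rewrite leNgt|].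
    rewrite -rw; apply: le_trans (sqn_le_rnorm2 _ j); rewrite mxE.
    rewrite le_eqVlt; apply/orP; left; apply/eqP.
    by case: (e); rewrite ?expr1 ?expr0 ?mulN1r ?mul1r ?sqnN.
  have gain : (b - t) * th ^+ 2 <= diagform dt V w.
    rewrite -rw -(rnorm2_unitary _ VU) mulr_sumr; apply: ler_sum => i _.
    have [di|di] := boolP (b <= d i).
      by rewrite ler_wpM2r ?sqn_ge0 // lerB.
    by rewrite wI // sqn0 !mulr0.
  have := diagform_parallelogram dt V z w.
  have := polydisc_sup_ge dt VU (wD false).
  have := polydisc_sup_ge dt VU (wD true).
  rewrite expr0 expr1 scaleN1r scale1r => ub1 ub2 par.
  lra.
have zm : m%:R * (1 - th) ^+ 2 <= rnorm2 z.
  apply: (@le_trans _ _ (\sum_(j | J j) (1 - th) ^+ 2)).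
    by rewrite sumr_const -[leRHS]mulr_natl ler_wpM2r ?sqr_ge0 // ler_nat.
  rewrite /rnorm2 [leRHS](bigID J) /=; apply: ler_wpDr; last first.
    by apply: ler_sum => j /ltW.
  by apply: sumr_ge0 => j _; exact: sqn_ge0.
have := polydisc_sup_ge d VU zD.
have -> : diagform d V z = diagform dt V z + t * rnorm2 z.
  by rewrite diagform_shift // subrK.
have : polydisc_sup (fun i => d i - b) V <= polydisc_sup dt V.
  by apply: le_polydisc_sup => // i; rewrite lerB // ltW.
have : t * (m%:R * (1 - th) ^+ 2) <= t * rnorm2 z by rewrite ler_wpM2l // ltW.
lra.
Qed.

(** The limit of the previous inequality for [t] tending to [b] and [th] to 0. *)
Lemma polydisc_sup_step d V (b : R) : V \is unitarymx -> 0 < b ->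
  polydisc_sup (fun i => d i - b) V + b * #|[pred i | b <= d i]|%:R
    <= polydisc_sup d V.
Proof.
move=> VU b0; set m := #|_|; apply/ler_addgt0Pr => e e0.
(* The first-order loss in th, from (1 - th)^3 >= 1 - 3 th and th^3 <= th,
   is at most th * c. *)
pose c := b * (3 * m%:R + 1).
have c0 : 0 < c by rewrite mulr_gt0 // ltr_wpDl // mulr_ge0.
pose th := e / (e + c).
have ec0 : 0 < e + c by rewrite addr_gt0.
have th0 : 0 < th by rewrite divr_gt0.
have th1 : th < 1 by rewrite ltr_pdivrMr // mul1r ltrDl.
have thc : th * c <= e.
  by rewrite /th mulrAC ler_pdivrMr // ler_wpM2l ?ltW // ltrDr.
clearbody th.
have t0 : 0 < b * (1 - th) by rewrite mulr_gt0 ?subr_gt0.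
have tb : b * (1 - th) < b by rewrite gtr_pMr // gtrBl.
have := polydisc_sup_drop d VU t0 tb th0 th1; rewrite -/m.
have m0 : 0 <= m%:R :> R by [].
move: thc m0; rewrite /c; move: (m%:R : R) => M thc M0.
set S' := polydisc_sup _ _; set S := polydisc_sup _ _ => drop.
apply: le_trans (lerD drop thc).
have h1 : 0 <= th ^+ 2 * (3 - th) by rewrite mulr_ge0 ?sqr_ge0 // subr_ge0 (le_trans (ltW th1)) // ler1n.
have h2 : 0 <= b * M * (th ^+ 2 * (3 - th)).
  by apply: mulr_ge0 => //; apply: mulr_ge0 => //; exact: ltW.
have h3 : 0 <= b * th * (1 - th ^+ 2).
  apply: mulr_ge0; first exact/ltW/mulr_gt0.
  by rewrite subr_ge0 expr_le1 // ltW.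
rewrite -subr_ge0.
rewrite [leRHS](_ : _ = b * M * (th ^+ 2 * (3 - th)) + b * th * (1 - th ^+ 2)).
  exact: addr_ge0.
ring.
Qed.

(** Shifting by the smallest positive eigenvalue [b] removes [b] times the number of
positive eigenvalues from the right-hand side at least and from the left-hand
side exactly, and leaves fewer positive eigenvalues. *)
Lemma polydisc_sup_ge_pospart d V : V \is unitarymx ->
  \sum_i Num.max (d i) 0 <= polydisc_sup d V.
Proof.
move=> VU; move: {2}#|[pred i | 0 < d i]|.+1 (ltnSn #|[pred i | 0 < d i]|) => k.
elim: k d => // k IH d; rewrite ltnS => dk.
have [i0 di0|d0] := pickP [pred i | 0 < d i]; last first.
  rewrite big1 => [|i _]; last by apply/max_idPr; rewrite leNgt; have /= -> := d0 i.
  apply: le_trans (polydisc_sup_ge d VU polydisc0).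
  by rewrite /diagform big1 // => i _; rewrite mul0mx mxE sqn0 mulr0.
case: (arg_minP d di0) => i1 /= di1 dmin.
have /IH IH1 : (#|[pred i | (0 < d i - d i1)%R]| < k)%N.
  apply: leq_trans dk; apply: proper_card; apply/properP; split.
    by apply/fintype.subsetP => i; rewrite !inE subr_gt0; exact: lt_trans.
  by exists i1; rewrite !inE ?subrr ?ltxx.
have step := polydisc_sup_step d VU di1.
apply: le_trans step; apply: le_trans (lerD IH1 (lexx _)).
rewrite mulr_natr -sumr_const [X in _ + X]big_mkcond -big_split /=; apply: ler_sum => i _.
rewrite inE; have [di|di] := leP (d i1) (d i).
  rewrite max_l ?(le_trans (ltW di1)) // -lerBlDr.
  by rewrite le_max lexx.
have di_le0 : d i <= 0 by rewrite leNgt; apply/negP => /dmin; rewrite leNgt di.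
by rewrite addr0 (max_idPr di_le0) le_max lexx orbT.
Qed.

End QuadraticForms.

(** * Greedy approximation of Gram matrices *)

Section Greedy.
Local Open Scope complex_scope.
Local Open Scope sesquilinear_scope.
Variable R : realType.
Local Notation C := R[i].

Lemma hermitian_diagonalization n (A : 'M[C]_n) :
  (forall j l, A l j = ((A j l)^* )%R) ->
  exists (V : 'M[C]_n) (d : 'I_n -> R), V \is unitarymx /\
    forall j l, A j l = \sum_i (d i)%:C * (V j i * ((V l i)^* )%R).
Proof.
move=> Aherm.
have hA : A \is hermsymmx.
  apply/is_hermitianmxP/matrixP => i j.
  by rewrite !mxE expr0 mul1r -Aherm.
have /orthomx_spectralP AE := hermitian_normalmx hA.
pose P := spectralmx A; pose sp := spectral_diag A.
have PU : P \is unitarymx by exact: spectral_unitarymx.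
have spR i : sp 0 i = (complex.Re (sp 0 i))%:C.
  by rewrite RRe_real // (mxOverP (hermitian_spectral_diag_real hA)).
exists (P ^t*), (fun i => complex.Re (sp 0 i)); split; first by rewrite trmxC_unitary.
move=> j l; rewrite {1}AE -/P -/sp invmx_unitary //.
rewrite mul_mx_diag mxE; apply: eq_bigr => i _.
by rewrite !mxE -spR conjCK mulrAC mulrA [sp 0 i * _]mulrC mulrAC.
Qed.

Variables (H : complexHilbert R) (x : nat -> H).
Hypothesis xB : bessel1 x.

Local Notation G j l := (inner (x j) (x l)).

Lemma inner_suml n (c : 'I_n -> C) (u : 'I_n -> H) v :
  inner (\sum_j c j *: u j) v = \sum_j c j * inner (u j) v.
Proof.
by rewrite linear_sumlz; apply: eq_bigr => j _; rewrite linearZl_LR.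
Qed.

Lemma inner_sumr n (c : 'I_n -> C) (u : 'I_n -> H) v :
  inner v (\sum_j c j *: u j) = \sum_j ((c j)^* )%R * inner v (u j).
Proof.
by rewrite linear_sumr; apply: eq_bigr => j _; rewrite linearZr_LR.
Qed.

Lemma inner_conj (u v : H) : inner v u = ((inner u v)^* )%R.
Proof. by rewrite hermC expr0 mul1r. Qed.

(** The trace is the sum of the [d i] times the squared norms of the vectors
[y i := \sum_j V j i *: x j], and these norms are at most 1 by the Bessel bound
applied to the unit vectors [V j i], [j < n]. *)
Lemma trace_gram_le n (A V : 'M[C]_n) (d : 'I_n -> R) :
  V \is unitarymx ->
  (forall j l, A j l = \sum_i (d i)%:C * (V j i * ((V l i)^* )%R)) ->
  complex.Re (\sum_j \sum_l A j l * G j l) <= \sum_i Num.max (d i) 0.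
Proof.
move=> VU AE; pose y (i : 'I_n) := \sum_(j < n) V j i *: x j.
have -> : \sum_j \sum_l A j l * G j l = \sum_i (d i)%:C * `|y i| ^+ 2.
  under [RHS]eq_bigr => i _.
    rewrite sqr_norm_inner {1}/y inner_suml mulr_sumr.
    under eq_bigr => j _ do rewrite /y inner_sumr !mulr_sumr.
    over.
  rewrite [RHS]exchange_big; apply: eq_bigr => j _.
  rewrite [RHS]exchange_big; apply: eq_bigr => l _.
  by rewrite AE mulr_suml; apply: eq_bigr => i _; rewrite !mulrA.
rewrite raddf_sum; apply: ler_sum => i _.
have y1 : `|y i| ^+ 2 <= 1.
  have := xB (fun j => V j i); rewrite -/(y i) => /le_trans; apply.
  have /unitarymxP/mulmx1C/matrixP/(_ i i) := VU; rewrite !mxE eqxx mulr1n => <-.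
  by apply: ler_sum => j _; rewrite !mxE normCK mulrC.
have /complex_realP[r yr] : `|y i| ^+ 2 \is Num.real.
  by rewrite ger0_real // exprn_ge0.
have r0 : 0 <= r by rewrite -lecR -yr exprn_ge0.
have r1 : r <= 1 by rewrite -lecR -yr.
rewrite yr -rmorphM /=.
have [d0|d0] := leP 0 (d i); first by rewrite ler_piMr.
by rewrite mulr_le0_ge0 // ltW.
Qed.

Lemma diagform_matrix n (A V : 'M[C]_n) (d : 'I_n -> R) (z : 'rV[C]_n) :
  (forall j l, A j l = \sum_i (d i)%:C * (V j i * ((V l i)^* )%R)) ->
  \sum_j \sum_l A j l * (z 0 j * ((z 0 l)^* )%R) = (diagform d V z)%:C.
Proof.
move=> AE; rewrite /diagform rmorph_sum /=.
under [RHS]eq_bigr => i _.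
  rewrite rmorphM /= sqnE mxE rmorph_sum mulr_suml mulr_sumr /=.
  under eq_bigr => j _ do rewrite !mulr_sumr.
  over.
rewrite [RHS]exchange_big; apply: eq_bigr => j _.
rewrite [RHS]exchange_big; apply: eq_bigr => l _.
rewrite AE mulr_suml; apply: eq_bigr => i _.
by rewrite rmorphM /=; ring.
Qed.

(** The left-hand side is the inner product of [D] with the change that [z] brings to
the residual; it becomes small when [z] nearly maximizes the Hermitian form of
the conjugate of [D], whose supremum over the polydisc is at least the trace
against the Gram matrix. *)
Lemma exists_descent n (D : 'M[C]_n) : (forall j l, D l j = ((D j l)^* )%R) ->
  exists2 z : 'rV[C]_n, in_polydisc z &
    complex.Re (\sum_j \sum_l (D j l)^* *
      (G j l - z 0 j * ((z 0 l)^* )%R))%R <= 1.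
Proof.
move=> Dherm; pose A : 'M[C]_n := \matrix_(j, l) ((D j l)^* )%R.
have Aherm j l : A l j = ((A j l)^* )%R by rewrite !mxE Dherm.
have [V [d [VU AE]]] := hermitian_diagonalization Aherm.
have [z zD zmax] := polydisc_sup_approx d VU (@ltr01 R).
exists z => //.
have -> : (\sum_j \sum_l (D j l)^* * (G j l - z 0 j * ((z 0 l)^* )%R))%R =
   \sum_j \sum_l A j l * G j l - (diagform d V z)%:C.
  rewrite -(diagform_matrix _ AE) -sumrB; apply: eq_bigr => j _.
  by rewrite -sumrB; apply: eq_bigr => l _; rewrite mulrBr !mxE.
rewrite raddfB /=.
have := trace_gram_le VU AE.
have := polydisc_sup_ge_pospart d VU.
lra.
Qed.

Definition residual n (s : seq 'rV[C]_n) : 'M[C]_n :=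
  \matrix_(j, l) ((size s)%:R * G j l - \sum_(z <- s) z 0 j * ((z 0 l)^* )%R).

(** Adding one point changes the squared Hilbert-Schmidt norm of the residual by a
bounded term plus twice an inner product which a suitable point keeps at most 1. *)
Lemma greedy_averages n : exists c : R, forall k, exists s : seq 'rV[C]_n,
  [/\ size s = k, forall z, z \in s -> in_polydisc z &
      \sum_j \sum_l sqn (residual s j l) <= k%:R * c].
Proof.
exists ((\sum_(j < n) \sum_(l < n) (Num.sqrt (sqn (G j l)) + 1) ^+ 2) + 2).
elim=> [|k [s [sk sD sres]]].
  exists [::]; split => //; rewrite mul0r big1 // => j _; rewrite big1 // => l _.
  by rewrite mxE big_nil mul0r subr0 sqn0.
have rherm j l : residual s l j = ((residual s j l)^* )%R.
  rewrite !mxE rmorphB rmorphM /= rmorph_nat -inner_conj; congr (_ - _).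
  by rewrite rmorph_sum; apply: eq_bigr => z _; rewrite rmorphM /= conjCK mulrC.
have [z zD zdesc] := exists_descent rherm.
exists (z :: s); split => [|w|]; first by rewrite /= sk.
  by rewrite inE => /orP[/eqP ->|/sD].
have resE j l : residual (z :: s) j l =
    residual s j l + (G j l - z 0 j * ((z 0 l)^* )%R).
  by rewrite !mxE big_cons /= -natr1; ring.
have -> : \sum_j \sum_l sqn (residual (z :: s) j l) =
    \sum_j \sum_l sqn (residual s j l) +
    (\sum_(j < n) \sum_(l < n) sqn (G j l - z 0 j * ((z 0 l)^* )%R) +
    2 * complex.Re (\sum_(j < n) \sum_(l < n) ((residual s j l)^* *
      (G j l - z 0 j * ((z 0 l)^* ))))%R).
  rewrite raddf_sum mulr_sumr -big_split -big_split; apply: eq_bigr => j _.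
  rewrite raddf_sum mulr_sumr -big_split -big_split; apply: eq_bigr => l _.
  by rewrite resE sqnD -addrA.
rewrite -[k.+1%:R]natr1 [leRHS]mulrDl mul1r.
apply: lerD => //; apply: lerD.
  apply: ler_sum => j _; apply: ler_sum => l _; apply: sqn_add_le => //.
    by rewrite sqr_sqrtr ?sqn_ge0.
  by rewrite sqnN expr1n sqnM sqnJ mulr_ile1 ?sqn_ge0 //; exact: zD.
by rewrite -[leRHS]mulr1 ler_wpM2l.
Qed.

Lemma gram_approximation n (e : R) : 0 < e -> exists s : seq 'rV[C]_n,
  [/\ (0 < size s)%N, forall z, z \in s -> in_polydisc z &
      forall j l : 'I_n,
        sqn (G j l - (size s)%:R^-1 * \sum_(z <- s) z 0 j * ((z 0 l)^* )%R)
          <= e].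
Proof.
move=> e0; have [c greedy] := greedy_averages n.
pose k := (Num.truncn (c / e)).+1.
have [s [sk sD sres]] := greedy k.
have ck : c <= e * k%:R.
  by rewrite mulrC -ler_pdivrMr // ltW // truncnS_gt.
have k0 : k%:R != 0 :> C by rewrite pnatr_eq0.
exists s; split => //; first by rewrite sk.
move=> j l.
have rE : residual s j l = (k%:R : R)%:C *
    (G j l - (size s)%:R^-1 * \sum_(z <- s) z 0 j * ((z 0 l)^* )%R).
  by rewrite mxE sk rmorph_nat mulrBr mulrA divff // mul1r.
have : sqn (residual s j l) <= k%:R * c.
  apply: le_trans sres; rewrite (bigD1 j) //= (bigD1 l) //= -addrA lerDl.
  rewrite addr_ge0 //; first by apply: sumr_ge0 => i _; exact: sqn_ge0.
  by apply: sumr_ge0 => i _; apply: sumr_ge0 => i' _; exact: sqn_ge0.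
rewrite rE sqn_real expr2 -mulrA ler_pM2l ?ltr0n // => /le_trans /(_ ck).
by rewrite mulrC ler_pM2r ?ltr0n.
Qed.

End Greedy.

(** * Nested subdivisions of the unit interval *)

Section ClusterFamily.
Variable R : realType.

(** All entries converge along one ultrafilter finer than the filter of
neighbourhoods of infinity, and finitely many convergences hold simultaneously
on a set of this ultrafilter. *)
Lemma cluster_family (W : eqType) (a : nat -> W -> R) :
  (forall n w, 0 <= a n w <= 1) ->
  exists m : W -> R, forall (ws : seq W) (e : R) (N : nat), 0 < e ->
    exists2 n, (N <= n)%N & forall w, w \in ws -> `|a n w - m w| < e.
Proof.
move=> a01.
have [U [UU sU]] := @ultraFilterLemma nat \oo _.
have lim w : exists p : R, (a ^~ w) @ U --> p.
  have : compact `[0 : R, 1] by exact: segment_compact.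
  move=> /(_ (a ^~ w @ U)) [|p [_ pcl]].
    apply: (@filterS _ U _ setT) filterT => n _.
    by rewrite /= in_itv /= a01.
  exists p => B Bp; have [//|UB] := in_ultra_setVsetC (a ^~ w @^-1` B) UU.
  by have [y [nBy]] := pcl (~` B) B UB Bp; move/nBy.
have [m mP] := choice lim.
exists m => ws e N e0.
have : U [set n | (N <= n)%N /\ forall w, w \in ws -> `|a n w - m w| < e].
  elim: ws => [|w ws IH].
    by apply: filterS (sU _ (nbhs_infty_ge N)) => n /= Nn; split.
  have /cvgrPdist_lt/(_ e e0) wU := mP w.
  apply: filterS2 IH wU => n [Nn IHn] wn; split => // v.
  by rewrite inE => /orP[/eqP ->|/IHn//]; rewrite distrC.
by case/filter_ex => n [Nn nP]; exists n.
Qed.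

End ClusterFamily.

Lemma take_rcons_leq (T : Type) k (s : seq T) b :
  (k <= size s)%N -> take k (rcons s b) = take k s.
Proof. by move=> ks; rewrite -cats1 takel_cat. Qed.

Lemma bounded_integrable01 (R : realType) (b : bool) (f : R -> R) (M : R) :
  measurable_fun [set` Interval (BLeft (0 : R)) (BSide b 1)] f ->
  (forall t, 0 <= t <= 1 -> `|f t| <= M) ->
  (@lebesgue_measure R).-integrable [set` Interval (BLeft (0 : R)) (BSide b 1)]
    (EFin \o f).
Proof.
move=> mf fM; apply: measurable_bounded_integrable => //.
- have : (@lebesgue_measure R [set` Interval (BLeft (0 : R)%R) (BSide b 1%R)] < +oo)%E.
    by rewrite lebesgue_measure_itv /= lte_fin ltr01 -EFinB ltry.
  exact.
- exists M; split => [|x Mx t /=]; first exact: num_real.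
  rewrite in_itv /= => /andP[t0 t1]; apply: le_trans (ltW Mx); apply: fM.
  by rewrite t0; case: b t1 {mf} => //= /ltW.
Qed.

Section BinaryTree.
Variables (R : realType) (m : seq bool -> R).
Hypothesis m_ge0 : forall w, 0 <= m w.
Hypothesis m_nil : m [::] = 1.
Hypothesis m_rcons : forall w, m (rcons w false) + m (rcons w true) = m w.

(** Every digit 1 of [w] skips the left sibling of the node reached by that digit, so
that the cells of two siblings are adjacent and fill the cell of their parent. *)
Definition left_end (w : seq bool) : R :=
  \sum_(s < size w | nth false w s) m (rcons (take s w) false).

Lemma left_end_rcons w b :
  left_end (rcons w b) = left_end w + (if b then m (rcons w false) else 0).
Proof.
rewrite /left_end size_rcons big_mkcond big_ord_recr /= nth_rcons ltnn eqxx.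
rewrite take_rcons_leq // take_size; congr (_ + _).
rewrite [RHS]big_mkcond; apply: eq_bigr => s _ /=.
by rewrite nth_rcons ltn_ord take_rcons_leq // ltnW.
Qed.

(** The word of length [S] whose cell contains [t], when [t] lies in [[0, 1[]. *)
Fixpoint branch (t : R) (S : nat) : seq bool :=
  if S is S'.+1 then
    let w := branch t S' in rcons w (left_end w + m (rcons w false) <= t)
  else [::].

Lemma size_branch t S : size (branch t S) = S.
Proof. by elim: S => //= S IH; rewrite size_rcons IH. Qed.

Lemma take_branch t S S' : (S <= S')%N -> take S (branch t S') = branch t S.
Proof.
elim: S' => [|S' IH]; first by rewrite leqn0 => /eqP ->.
rewrite leq_eqVlt => /orP[/eqP ->|SS'].
  by rewrite take_oversize // size_branch.
by rewrite /= take_rcons_leq ?size_branch // IH.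
Qed.

Lemma nth_branch t s S : (s < S)%N ->
  nth false (branch t S) s = nth false (branch t s.+1) s.
Proof. by move=> sS; rewrite -(take_branch t sS) nth_take. Qed.

Definition cell (w : seq bool) : set R :=
  [set t | left_end w <= t < left_end w + m w].

Lemma cell_nil t : cell [::] t = (0 <= t < 1) :> Prop.
Proof. by rewrite /cell /= /left_end big_ord0 m_nil add0r. Qed.

Lemma cell_rcons w b : cell (rcons w b) `<=` cell w.
Proof.
move=> t; rewrite /cell /= left_end_rcons.
have := m_rcons w; have := m_ge0 (rcons w true); have := m_ge0 (rcons w false).
by case: b => ? ? ? /andP[? ?]; apply/andP; split; lra.
Qed.

Lemma cell_sub01 w : cell w `<=` [set t | 0 <= t < 1].
Proof.
elim/last_ind: w => [|w b IH] t; first by rewrite cell_nil.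
by move/cell_rcons/IH.
Qed.

Lemma branch_cell t S : 0 <= t < 1 -> cell (branch t S) t.
Proof.
move=> t01; elim: S => [|S]; first by rewrite /= cell_nil.
rewrite /cell /= left_end_rcons; set w := branch t S.
have := m_rcons w.
by case: (leP (left_end w + m (rcons w false)) t) => ? ? /andP[? ?];
  apply/andP; split; lra.
Qed.

Lemma cell_branch w t : cell w t -> branch t (size w) = w.
Proof.
elim/last_ind: w => [//|w b IH] wb; have wt := cell_rcons wb.
rewrite size_rcons /= IH //; congr rcons.
move: wb; rewrite /cell /= left_end_rcons.
case: b {IH} => /= /andP[wt1 wt2]; first by rewrite wt1.
by apply/negbTE; rewrite -ltNge; move: wt2; rewrite addr0.
Qed.

(** Cells are half-open, so cells of mass 0 are empty. This is what confines the
limit functions to values approximated by actual points. *)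
Lemma branch_gt0 t S : 0 <= t < 1 -> 0 < m (branch t S).
Proof.
by move=> /(branch_cell S) /andP[le_t t_lt]; have := le_lt_trans le_t t_lt; lra.
Qed.

Lemma measurable_branch w : measurable [set t | branch t (size w) = w].
Proof.
elim/last_ind: w => [|w b IH].
  by rewrite (_ : [set _ | _] = setT) //; apply/seteqP; split.
rewrite size_rcons.
have -> : [set t | branch t (size w).+1 = rcons w b] =
  [set t | branch t (size w) = w] `&`
  [set` if b then `[left_end w + m (rcons w false), +oo[%R
   else `]-oo, left_end w + m (rcons w false)[%R].
  apply/seteqP; split => t /=.
    move=> /rcons_inj [wE <-]; split => //; rewrite wE.
    by case: (leP (left_end w + m (rcons w false)) t) => tw;
      rewrite /= in_itv /= ?andbT.
  move=> [wE tb]; rewrite wE; congr rcons; move: tb; case: b; rewrite /= in_itv /= ?andbT //.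
  by rewrite leNgt => ->.
by apply: measurableI => //; case: b; exact: measurable_itv.
Qed.

Lemma branch_indic_sum (phi : seq bool -> R) t S :
  phi (branch t S) =
  \sum_(w : S.-tuple bool) phi w * \1_[set u | branch u (size w) = w] t.
Proof.
have bS : size (branch t S) == S by rewrite size_branch.
rewrite (bigD1 (Tuple bS)) //= big1 ?addr0 => [|w wt].
  by rewrite indicE mem_set ?mulr1 //= size_branch.
rewrite indicE memNset ?mulr0 //= size_tuple => tw.
by case/eqP: wt; apply: val_inj; rewrite /= tw.
Qed.

Lemma measurable_fun_branch (phi : seq bool -> R) S D :
  measurable_fun D (fun t => phi (branch t S)).
Proof.
under [X in measurable_fun _ X]eq_fun do rewrite branch_indic_sum.
apply: measurable_sum => w; apply: measurable_funM => //.
by apply: measurable_indic; exact: measurable_branch.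
Qed.

Lemma lebesgue_cell w : (@lebesgue_measure R) (cell w) = (m w)%:E.
Proof.
have -> : cell w = [set` `[left_end w, left_end w + m w[].
  by apply/seteqP; split => t; rewrite /= in_itv.
rewrite lebesgue_measure_itv /= lte_fin ltrDl.
have [_|m0] := ltP 0 (m w); first by rewrite -EFinD addrAC subrr add0r.
by congr EFin; apply/eqP; rewrite eq_le m_ge0.
Qed.

Lemma Rintegral_branch (phi : seq bool -> R) S :
  \int[lebesgue_measure]_(t in `[0, 1]) phi (branch t S) =
  \sum_(w : S.-tuple bool) phi w * m w.
Proof.
have mI : measurable (`[0, 1[ : set (measurableTypeR R)) by exact: measurable_itv.
have ind_int w : (@lebesgue_measure R).-integrable `[0, 1[
    (EFin \o \1_[set u | branch u (size w) = w]).
  apply: (@bounded_integrable01 _ true _ 1) => [|t _].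
    by apply: measurable_indic; exact: measurable_branch.
  by rewrite indicE; case: (_ \in _); rewrite ?normr1 ?normr0.
have term_int (w : S.-tuple bool) : (@lebesgue_measure R).-integrable `[0, 1[
    (EFin \o (fun t => phi w * \1_[set u | branch u (size w) = w] t)).
  by have := integrableZl mI (phi w) (ind_int w).
have intE : (@lebesgue_measure R).-integrable `[0, 1[
    (EFin \o (fun t => phi (branch t S))).
  under [X in integrable _ _ X]eq_fun do rewrite /= branch_indic_sum -sumEFin.
  by apply: integrable_sum => // w _; exact: term_int.
rewrite -Rintegral_itv_bndo_bndc // /Rintegral.
under eq_integral do rewrite branch_indic_sum -sumEFin.
rewrite integral_sum //.
rewrite -sum_fine; last first.
  by move=> w _; exact: (integrable_fin_num mI (term_int w)).
apply: eq_bigr => w _; rewrite [LHS](RintegralZl (phi w) mI (ind_int w)).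
congr (_ * _); rewrite /Rintegral integral_indic //; last exact: measurable_branch.
suff -> : [set u | branch u (size w) = w] `&` `[0, 1[ = cell w.
  exact: (congr1 fine (lebesgue_cell w)).
apply/seteqP; split => t /=.
  by move=> [tw]; rewrite in_itv /= => /(branch_cell (size w)); rewrite tw.
by move=> wt; split; [exact: cell_branch|rewrite in_itv /=; exact: cell_sub01 wt].
Qed.

End BinaryTree.

(** * Limits of empirical laws *)

Section SignedDigits.
Variable R : realType.
Implicit Types (y : R) (p : nat -> R) (beta : nat -> bool).

Definition bsign (b : bool) : R := if b then 1 else -1.

(** Expansion with digits 1 and -1. It represents all of [[-1, 1]], end points
included, with remainders that stay in [[-1, 1]]. *)
Fixpoint digit_rem y e : R :=
  if e is e'.+1 then
    let r := digit_rem y e' in 2 * r - bsign (0 <= r)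
  else y.

Definition digit y e : bool := 0 <= digit_rem y e.

Lemma digit_rem_le1 y e : `|y| <= 1 -> `|digit_rem y e| <= 1.
Proof.
move=> y1; elim: e => //= e; rewrite !ler_norml /bsign => /andP[r1 r2].
by case: (leP 0 (digit_rem y e)) => r0; apply/andP; split; lra.
Qed.

Lemma digit_expansion y E : y =
  \sum_(e < E) 2^-1 ^+ e.+1 * bsign (digit y e) + 2^-1 ^+ E * digit_rem y E.
Proof.
elim: E => [|E IH]; first by rewrite big_ord0 expr0 mul1r add0r.
rewrite {1}IH big_ord_recr /= -addrA; congr (_ + _).
by rewrite -/(digit y E) exprS; field.
Qed.

Definition digit_index (a e : nat) : nat := pickle (a, e).

(** The digits of all coordinates, interleaved into a single sequence. *)
Definition digits_of p (s : nat) : bool :=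
  if unpickle s is Some (a, e) then digit (p a) e else false.

Lemma digits_ofE p a e : digits_of p (digit_index a e) = digit (p a) e.
Proof. by rewrite /digits_of /digit_index pickleK. Qed.

Definition trunc_value (a E : nat) beta : R :=
  \sum_(e < E) 2^-1 ^+ e.+1 * bsign (beta (digit_index a e)).

Lemma trunc_value_cauchy a E E' beta : (E <= E')%N ->
  `|trunc_value a E' beta - trunc_value a E beta| <= 2^-1 ^+ E - 2^-1 ^+ E'.
Proof.
elim: E' => [|E' IH]; first by rewrite leqn0 => /eqP ->; rewrite !subrr normr0.
rewrite leq_eqVlt => /orP[/eqP ->|EE']; first by rewrite !subrr normr0.
rewrite {1}/trunc_value big_ord_recr /= -/(trunc_value a E' beta) addrAC.
apply: le_trans (ler_normD _ _) _; have := IH EE'.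
have -> : `|2^-1 ^+ E'.+1 * bsign (beta (digit_index a E'))| = 2^-1 ^+ E'.+1 :> R.
  rewrite normrM ger0_norm ?exprn_ge0 ?invr_ge0 // /bsign.
  by case: ifP => _; rewrite ?normrN1 ?normr1 mulr1.
rewrite exprS; lra.
Qed.

Lemma trunc_value_le1 a E beta : `|trunc_value a E beta| <= 1.
Proof.
have := trunc_value_cauchy a beta (leq0n E).
rewrite {2}/trunc_value big_ord0 subr0 expr0 => /le_trans; apply.
by rewrite gerBl exprn_ge0 ?invr_ge0.
Qed.

Lemma trunc_value_digits p a E : `|p a| <= 1 ->
  `|p a - trunc_value a E (digits_of p)| <= 2^-1 ^+ E.
Proof.
move=> p1; rewrite {1}(digit_expansion (p a) E) /trunc_value.
under [X in _ - X]eq_bigr do rewrite digits_ofE.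
rewrite addrAC subrr add0r normrM ger0_norm ?exprn_ge0 ?invr_ge0 //.
by rewrite ler_piMr ?exprn_ge0 ?invr_ge0 // digit_rem_le1.
Qed.

(** The length of an initial segment of the interleaved sequence that contains the
first [E] digits of coordinate [a]. *)
Definition depth (a E : nat) : nat := \max_(e < E) (digit_index a e).+1.

Lemma eq_trunc_value a E S beta beta' : (depth a E <= S)%N ->
  (forall s, (s < S)%N -> beta s = beta' s) ->
  trunc_value a E beta = trunc_value a E beta'.
Proof.
move=> dS bb'; apply: eq_bigr => e _; rewrite bb' //.
by apply: leq_trans dS; exact: (leq_bigmax e).
Qed.

Lemma half_expn_lt (e : R) : 0 < e -> exists E, 2^-1 ^+ E < e.
Proof.
move=> e0; have : (2^-1 : R) ^+ n @[n --> \oo] --> (0 : R).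
  by apply: cvg_expr; rewrite ger0_norm ?invr_ge0 // invf_lt1 // ltr1n.
move/cvgrPdist_lt => /(_ e e0) [E _ /(_ E (leqnn _))].
rewrite sub0r normrN ger0_norm ?exprn_ge0 ?invr_ge0 //; by exists E.
Qed.

End SignedDigits.

Section EmpiricalFrequencies.
Variable R : realType.
Variables (k : nat) (beta : nat -> nat -> bool).
Hypothesis k_gt0 : (0 < k)%N.

Definition average (F : nat -> R) : R := k%:R^-1 * \sum_(i < k) F i.

(** The share of the sequences [beta i], [i < k], that begin with [w]. *)
Definition freq (w : seq bool) : R :=
  average (fun i => (mkseq (beta i) (size w) == w)%:R).

Lemma le_average F F' : (forall i, (i < k)%N -> F i <= F' i) ->
  average F <= average F'.
Proof.
by move=> FF'; rewrite ler_wpM2l ?invr_ge0 //; apply: ler_sum => i _; exact: FF'.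
Qed.

Lemma average_cst (c : R) : average (fun=> c) = c.
Proof.
rewrite /average sumr_const card_ord -[c *+ k]mulr_natl mulrA mulVf ?mul1r //.
by rewrite pnatr_eq0 -lt0n.
Qed.

Lemma averageB F F' : average F - average F' = average (fun i => F i - F' i).
Proof. by rewrite /average sumrB mulrBr. Qed.

Lemma averageD F F' : average (fun i => F i + F' i) = average F + average F'.
Proof. by rewrite /average big_split mulrDr. Qed.

Lemma le_normr_average F (e : R) : (forall i, (i < k)%N -> `|F i| <= e) ->
  `|average F| <= e.
Proof.
move=> Fe; rewrite -[e]average_cst /average normrM ger0_norm ?invr_ge0 //.
rewrite ler_wpM2l ?invr_ge0 //; apply: le_trans (ler_norm_sum _ _ _) _.
by apply: ler_sum => i _; exact: Fe.
Qed.

Lemma freq01 w : 0 <= freq w <= 1.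
Proof.
apply/andP; split; last first.
  by rewrite -[leRHS](average_cst 1) le_average // => i _; by rewrite lern1 leq_b1.
by rewrite -[leLHS](average_cst 0) le_average.
Qed.

Lemma freq_nil : freq [::] = 1.
Proof. exact: average_cst. Qed.

Lemma freq_rcons w : freq (rcons w false) + freq (rcons w true) = freq w.
Proof.
rewrite /freq /average -mulrDr -big_split; congr (_ * _); apply: eq_bigr => i _ /=.
rewrite !size_rcons mkseqS !eqseq_rcons.
by case: (_ == w); case: (beta i _) => /=; rewrite ?addr0 ?add0r.
Qed.

Lemma freq_gt0 w : 0 < freq w ->
  exists2 i, (i < k)%N & mkseq (beta i) (size w) = w.
Proof.
apply: contraPP => nw; apply/negP; rewrite -leNgt -[leRHS](average_cst 0).
apply: le_average => i ik; case: eqP => // iw; case: nw; by exists i.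
Qed.

Lemma average_words (phi : seq bool -> R) S :
  average (fun i => phi (mkseq (beta i) S)) =
  \sum_(w : S.-tuple bool) phi w * freq w.
Proof.
under [RHS]eq_bigr => w _ do rewrite /freq /average mulrCA mulr_sumr.
rewrite /average -mulr_sumr; congr (_ * _); rewrite exchange_big.
apply: eq_bigr => i _ /=.
have bS : size (mkseq (beta i) S) == S by rewrite size_mkseq.
rewrite (bigD1 (Tuple bS)) //= big1 ?addr0 => [|w wt].
  by rewrite size_mkseq eqxx mulr1.
rewrite size_tuple; case: eqP => [iw|]; last by rewrite mulr0.
by case/eqP: wt; apply: val_inj; rewrite /= iw.
Qed.

End EmpiricalFrequencies.

Section LimitLaw.
Variable R : realType.

Lemma dist_mul_le (x y x' y' d : R) : `|x| <= 1 -> `|y'| <= 1 ->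
  `|x - x'| <= d -> `|y - y'| <= d -> `|x * y - x' * y'| <= 2 * d.
Proof.
move=> x1 y1 xd yd.
have -> : x * y - x' * y' = x * (y - y') + (x - x') * y' by ring.
apply: le_trans (ler_normD _ _) _; rewrite !normrM mulr_natl mulr2n.
by apply: lerD; rewrite -[leRHS]mul1r ?[_ * `|y'|]mulrC ler_pM.
Qed.

Lemma Rintegral01_close (f h : R -> R) (d M : R) :
  measurable_fun (`[0, 1] : set R) f -> measurable_fun (`[0, 1] : set R) h ->
  (forall t, 0 <= t <= 1 -> `|f t| <= M) -> (forall t, 0 <= t <= 1 -> `|h t| <= M) ->
  (forall t, 0 <= t <= 1 -> `|f t - h t| <= d) ->
  `|\int[lebesgue_measure]_(t in `[0, 1]) f t -
    \int[lebesgue_measure]_(t in `[0, 1]) h t| <= d.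
Proof.
move=> mf mh fM hM fhd.
have mI : measurable (`[0, 1] : set (measurableTypeR R)) by exact: measurable_itv.
have fI := bounded_integrable01 (b := false) mf fM.
have hI := bounded_integrable01 (b := false) mh hM.
have mfh : measurable_fun (`[0, 1] : set R) (fun t => f t - h t).
  exact: measurable_funB.
have fhI := bounded_integrable01 (b := false) mfh fhd.
have nI : (@lebesgue_measure R).-integrable `[0, 1]
    (EFin \o (fun t => `|f t - h t|)).
  apply: (bounded_integrable01 (b := false) (M := d)) => [|t t01].
    exact: measurableT_comp.
  by rewrite normr_id fhd.
have dI : (@lebesgue_measure R).-integrable `[0, 1] (EFin \o (fun=> d)).
  by apply: (bounded_integrable01 (b := false) (M := `|d|)).
rewrite -(RintegralB mI fI hI).
apply: le_trans (le_normr_Rintegral mI fhI) _.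
have -> : d = \int[lebesgue_measure]_(t in `[0, 1]) (fun=> d) t.
  rewrite (Rintegral_cst _ mI) [X in fine X](lebesgue_measure_itv `[0%R, 1%R]) /=.
  by rewrite lte_fin ltr01 -EFinB subr0 mulr1.
by apply: (le_Rintegral mI nI dI) => t /=; rewrite in_itv /=; exact: fhd.
Qed.

Lemma eq0_lt (x : R) : (forall e, 0 < e -> `|x| < e) -> x = 0.
Proof.
move=> xe; apply/eqP/negPn/negP => x0; have := xe `|x|.
by rewrite normr_gt0 ltxx => /(_ x0).
Qed.

Variables (k : nat -> nat) (p : nat -> nat -> nat -> R).
Hypothesis k_gt0 : forall n, (0 < k n)%N.
Hypothesis p_le1 : forall n i a, `|p n i a| <= 1.

Let beta n i := digits_of (p n i).

(** The uniform laws on the points [p n i], [i < k n], cluster at the law of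
[t |-> (g a t)_a] under Lebesgue measure. The third clause says that this law is
carried by the closure of the set of points, the fourth that second moments are
limits of second moments. *)
Lemma limit_law : exists g : nat -> R -> R,
  [/\ forall a, measurable_fun (`[0, 1] : set R) (g a),
      forall a t, `|g a t| <= 1,
      forall t M e, 0 <= t < 1 -> 0 < e -> exists n i, (i < k n)%N /\
        forall a, (a < M)%N -> `|g a t - p n i a| <= e &
      forall M N e, 0 < e -> exists2 n, (N <= n)%N &
        forall a b, (a < M)%N -> (b < M)%N ->
        `|\int[lebesgue_measure]_(t in `[0, 1]) (g a t * g b t) -
          average (k n) (fun i => p n i a * p n i b)| <= e].
Proof.
(* m w is the limit frequency of the word w; its additivity on the tree is inherited
   from the frequencies. *)
have [m mP] := cluster_family (fun n w => freq01 R (beta n) (k_gt0 n) w).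
have m_ge0 w : 0 <= m w.
  rewrite leNgt; apply/negP => m0.
  have m0' : 0 < - m w by rewrite oppr_gt0.
  have [n _ /(_ w)] := mP [:: w] _ 0%N m0'.
  rewrite inE eqxx => /(_ isT); rewrite ltr_norml => /andP[_].
  by have /andP[] := freq01 R (beta n) (k_gt0 n) w; lra.
have m_nil : m [::] = 1.
  apply/esym/eqP; rewrite -subr_eq0; apply/eqP/eq0_lt => e e0.
  have [n _ /(_ [::] (mem_head _ _))] := mP [:: [::]] e 0%N e0.
  by rewrite freq_nil.
have m_rcons w : m (rcons w false) + m (rcons w true) = m w.
  apply/eqP; rewrite -subr_eq0; apply/eqP/eq0_lt => e e0.
  have e30 : 0 < e / 3 by rewrite divr_gt0.
  have [n _ nP] := mP [:: rcons w false; rcons w true; w] _ 0%N e30.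
  have := nP (rcons w false); have := nP (rcons w true); have := nP w.
  rewrite !inE !eqxx !orbT => /(_ isT) + /(_ isT) + /(_ isT).
  have := freq_rcons R (k n) (beta n) w; rewrite !ltr_norml.
  by move=> ? /andP[? ?] /andP[? ?] /andP[? ?]; apply/andP; split; lra.
(* The infinite digit sequence of t, and its truncated coordinate values. *)
pose bits t s := nth false (branch m t s.+1) s.
have bitsE t s S : (s < S)%N -> bits t s = nth false (branch m t S) s.
  by move=> sS; rewrite /bits nth_branch.
pose X a E t := trunc_value R a E (bits t).
have X_cauchy a t E E' : (E <= E')%N -> `|X a E' t - X a E t| <= 2^-1 ^+ E.
  move=> EE'; apply: le_trans (trunc_value_cauchy _ _ _ EE') _.
  by rewrite gerBl exprn_ge0 ?invr_ge0.
have X_cvg a t : cvgn (fun E => X a E t).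
  apply: cauchy_cvg; apply: cauchy_exP => e e0; have [E Ee] := half_expn_lt e0.
  exists (X a E t); exists E => // E' /= EE'.
  by rewrite /ball /= distrC; apply: le_lt_trans Ee; exact: X_cauchy.
pose g a t := limn (fun E => X a E t).
have gX a t E : `|g a t - X a E t| <= 2^-1 ^+ E.
  apply/ler_addgt0Pr => e e0.
  have /cvgrPdist_lt/(_ e e0)[E' _ E'P] := X_cvg a t.
  have := E'P _ (leq_maxr E E'); have := X_cauchy a t _ _ (leq_maxl E E').
  rewrite -/(g a t) => h1 h2.
  rewrite -(subrKA (X a (maxn E E') t)) addrC.
  by apply: le_trans (ler_normD _ _) _; apply: lerD => //; exact: ltW.
have g1 a t : `|g a t| <= 1.
  apply/ler_addgt0Pr => e /half_expn_lt[E Ee].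
  rewrite -[g a t](subrK (X a E t)) addrC; apply: le_trans (ler_normD _ _) _.
  by apply: lerD; [exact: trunc_value_le1|exact: le_trans (gX _ _ _) (ltW Ee)].
have XE a E t S : (depth a E <= S)%N ->
    X a E t = trunc_value R a E (nth false (branch m t S)).
  by move=> dS; apply: (eq_trunc_value _ dS) => s sS; exact: bitsE.
have mX a E : measurable_fun (`[0, 1] : set R) (X a E).
  have -> : X a E = fun t => trunc_value R a E (nth false (branch m t (depth a E))).
    by apply/funext => t; exact: XE.
  exact: (measurable_fun_branch m (fun w => trunc_value R a E (nth false w))).
have mg a : measurable_fun (`[0, 1] : set R) (g a).
  by apply: (measurable_fun_cvg (h := X a)) => // t _; exact: X_cvg.
exists g; split => //.
- move=> t M e t01 e0.
  have e20 : 0 < e / 2 by rewrite divr_gt0.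
  have [E Ee] := half_expn_lt e20.
  (* The first S digits determine all first M coordinates up to 2^-E. *)
  pose S := \max_(a < M) depth a E; pose w := branch m t S.
  have w0 : 0 < m w by exact: branch_gt0.
  have [n _ /(_ w (mem_head _ _))] := mP [:: w] _ 0%N w0.
  rewrite ltr_norml => /andP[fw _].
  have /(freq_gt0 (k_gt0 n))[i ik iw] : 0 < freq R (k n) (beta n) w by lra.
  exists n, i; split => // a aM.
  have aS : (depth a E <= S)%N by exact: (leq_bigmax (Ordinal aM)).
  have Xi : X a E t = trunc_value R a E (beta n i).
    rewrite (XE _ _ _ _ aS) -/w -iw size_branch.
    by apply: (eq_trunc_value _ aS) => s sS; rewrite nth_mkseq.
  have := trunc_value_digits E (p_le1 n i a); have := gX a t E.
  rewrite Xi -/(beta n i) !ler_norml => /andP[? ?] /andP[? ?].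
  by apply/andP; split; lra.
- move=> M N e e0.
  have e60 : 0 < e / 6 by rewrite divr_gt0.
  have [E Ee] := half_expn_lt e60.
  pose S := \max_(a < M) depth a E.
  pose c : R := #|{: S.-tuple bool}|.+1%:R.
  have c0 : 0 < c by rewrite ltr0n.
  have d0 : 0 < e / 3 / c by rewrite !divr_gt0.
  have [n Nn nP] := mP [seq val w | w <- enum {: S.-tuple bool}] _ N d0.
  exists n => // a b aM bM.
  have aS : (depth a E <= S)%N by exact: (leq_bigmax (Ordinal aM)).
  have bS : (depth b E <= S)%N by exact: (leq_bigmax (Ordinal bM)).
  pose phi w := trunc_value R a E (nth false w) * trunc_value R b E (nth false w).
  have phi1 w : `|phi w| <= 1.
    by rewrite normrM mulr_ile1 // trunc_value_le1.
  (* Truncating the limit functions, exchanging masses with frequencies, and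
     truncating the points cost e / 3 each. *)
  have h1 : `|\int[lebesgue_measure]_(t in `[0, 1]) (g a t * g b t) -
      \int[lebesgue_measure]_(t in `[0, 1]) phi (branch m t S)| <= e / 3.
    apply: (Rintegral01_close (M := 1)).
    - exact: measurable_funM.
    - exact: measurable_fun_branch.
    - by move=> t _; rewrite normrM mulr_ile1.
    - by move=> t _.
    - move=> t _; rewrite /phi -(XE _ _ _ _ aS) -(XE _ _ _ _ bS).
      apply: (@le_trans _ _ (2 * 2^-1 ^+ E)); last by lra.
      by apply: dist_mul_le => //; exact: trunc_value_le1.
  have h2 : `|\sum_(w : S.-tuple bool) phi w * m w -
      \sum_(w : S.-tuple bool) phi w * freq R (k n) (beta n) w| <= e / 3.
    rewrite -sumrB; apply: le_trans (ler_norm_sum _ _ _) _.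
    apply: (@le_trans _ _ (\sum_(w : S.-tuple bool) e / 3 / c)).
      apply: ler_sum => w _; rewrite -mulrBr normrM -[leRHS]mul1r ler_pM //.
      by rewrite distrC ltW // nP // map_f // mem_enum.
    rewrite sumr_const -[leLHS]mulr_natr -mulrA ler_piMr ?divr_ge0 ?ltW //.
    by rewrite mulrC ltr_pdivrMr // mul1r ltr_nat.
  have h3 : `|average (k n) (fun i => phi (mkseq (beta n i) S)) -
      average (k n) (fun i => p n i a * p n i b)| <= e / 3.
    rewrite averageB; apply: le_normr_average => // i ik.
    apply: (@le_trans _ _ (2 * 2^-1 ^+ E)); last by lra.
    have mkE c' : (depth c' E <= S)%N ->
        trunc_value R c' E (nth false (mkseq (beta n i) S)) =
        trunc_value R c' E (beta n i).
      by move=> cS; apply: (eq_trunc_value _ cS) => s sS; rewrite nth_mkseq.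
    rewrite /phi !mkE //; apply: dist_mul_le => //.
    - exact: trunc_value_le1.
    - by rewrite distrC trunc_value_digits.
    - by rewrite distrC trunc_value_digits.
  rewrite Rintegral_branch // in h1; rewrite average_words in h3.
  move: h1 h2 h3; rewrite !ler_norml => /andP[? ?] /andP[? ?] /andP[? ?].
  by apply/andP; split; lra.
Qed.

End LimitLaw.

(** * The complex line and the optimality of the constant *)

Section ComplexLine.
Local Open Scope complex_scope.
Variable R : realType.
Local Notation C := R[i].

(** Real and imaginary parts of a Cauchy filter are Cauchy. *)
Lemma complex_complete (F : set_system C^o) : ProperFilter F -> cauchy F -> cvg F.
Proof.
move=> FF /cauchyP Fc.
have ReB (z w : C) : `|complex.Re z - complex.Re w|%:C <= `|z - w|.
  by rewrite -raddfB /= normc_ge_Re.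
have ImB (z w : C) : `|complex.Im z - complex.Im w|%:C <= `|z - w|.
  case: z w => [a b] [c d] /=; rewrite normc_def lecR /= -sqrtr_sqr.
  by rewrite ler_wsqrtr // lerDr sqr_ge0.
have part (h : C -> R) : (forall z w, `|h z - h w|%:C <= `|z - w|) ->
    cvg (h @ F).
  move=> hle; apply: cauchy_cvg; apply: cauchy_exP => e e0.
  have ec0 : (0 : C) < e%:C by rewrite ltcR.
  have [z Fz] := Fc _ ec0; exists (h z).
  apply: (@filterS _ F _ (ball z e%:C)) Fz => w; rewrite /ball /= => zw.
  by rewrite -ltcR; apply: le_lt_trans (hle _ _) zw.
have /cvg_ex[a Fa] := part (@complex.Re R) ReB.
have /cvg_ex[b Fb] := part (@complex.Im R) ImB.
apply/cvg_ex; exists (a +i* b : C^o); apply/cvgrPdist_lt => e e0.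
case/complex_realP: (gtr0_real e0) => r re; move: e0; rewrite {}re ltcR => r0.
have r20 : 0 < r / 2 by rewrite divr_gt0.
move/cvgrPdist_lt/(_ _ r20) : Fa; move/cvgrPdist_lt/(_ _ r20) : Fb => Fb Fa.
apply: (filterS2 (F := F)) Fa Fb => z /= az bz.
case: z az bz => c d /= az bz.
rewrite normc_def ltcR /= -[ltRHS]gtr0_norm // -sqrtr_sqr ltr_sqrt ?exprn_gt0 //.
move: az bz; rewrite !ltr_norml => /andP[? ?] /andP[? ?]; nra.
Qed.

(** A carrier of its own for the regular module, because the completeness of [_^o] is
canonically that of real scalars. *)
Definition cline : Type := C^o.

HB.instance Definition _ := NormedModule.copy cline C^o.
HB.instance Definition _ := Uniform_isComplete.Build cline complex_complete.

Definition line_inner (u v : cline) : C := u * (v^* )%R.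

Lemma line_inner_bilinear :
  bilinear_for ( *%R : GRing.Scale.law C C) (@Num.conj C \; *%R) line_inner.
Proof.
split=> u a v w; rewrite /line_inner.
  by rewrite mulrDl /= -mulrA.
by rewrite rmorphD rmorphM mulrDr /= mulrCA.
Qed.

HB.instance Definition _ := bilinear_isBilinear.Build C cline cline C _ _ line_inner
  line_inner_bilinear.

Lemma line_inner_hermitian (u v : cline) :
  line_inner u v = (-1) ^+ false * Num.conj (line_inner v u).
Proof. by rewrite /line_inner expr0 mul1r rmorphM /= conjCK mulrC. Qed.

HB.instance Definition _ :=
  isHermitianSesquilinear.Build C cline false (@Num.conj C) line_inner
    line_inner_hermitian.

Lemma line_inner_gt0 (u : cline) : u != 0 -> 0 < line_inner u u.
Proof. by move=> u0; rewrite /line_inner mul_conjC_gt0. Qed.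

HB.instance Definition _ := isDotProduct.Build C cline line_inner line_inner_gt0.

Lemma line_inner_norm (u : cline) : `|u| ^+ 2 = line_inner u u.
Proof. exact: normCK. Qed.

Definition complexLine : complexHilbert R :=
  @ComplexHilbert R cline line_inner line_inner_norm.

Definition unit_sequence (j : nat) : complexLine := if j is 0 then 1 else 0.

Lemma bessel_unit_sequence : bessel1 unit_sequence.
Proof.
case=> [|N] c; first by rewrite !big_ord0 normr0 expr0n.
rewrite !big_ord_recl /= big1 => [|j _]; last by rewrite scaler0.
rewrite addr0 [c ord0 *: _]mulr1 lerDl.
by apply: sumr_ge0 => j _; rewrite exprn_ge0.
Qed.

Lemma ae_lebesgue01 (P : R -> Prop) : {ae @lebesgue01 R, forall t, P t} ->
  {ae @lebesgue_measure R, forall t, I01 t -> P t}.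
Proof.
case=> A [mA A0 PA]; exists (A `&` @I01 R); split.
- exact: measurableI (@measurable_I01 R).
- exact: A0.
- by move=> t /= /not_implyP[It nPt]; split => //; exact: PA.
Qed.

Lemma lebesgue01_setT : @lebesgue01 R setT = 1%E.
Proof.
rewrite -[LHS]/(@lebesgue_measure R (setT `&` @I01 R)) setTI.
rewrite [LHS](lebesgue_measure_itv `[0%R, 1%R]) /=.
by rewrite lte_fin ltr01 -EFinB subr0.
Qed.

Lemma Linfty_norm_le1 (f : R -> C) : (Linfty_norm f <= 1)%E <->
  {ae @lebesgue01 R, forall t, Normc.normc (f t) <= 1}.
Proof.
rewrite /Linfty_norm unlock /Lnorm lebesgue01_setT lte01.
have FF := ae_filter_ringOfSetsType (@lebesgue01 R).
split=> [/ess_supP H|H]; [|apply/ess_supP]; apply: (filterS (Filter := FF)) H => t /=.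
  by rewrite lee_fin ger0_norm // normc_sqn sqrtr_ge0.
by move=> ft; rewrite lee_fin ger0_norm // normc_sqn sqrtr_ge0.
Qed.

Lemma Rintegral01_le1 (h : R -> R) : measurable_fun (@I01 R) h ->
  (forall t, 0 <= h t) ->
  {ae @lebesgue_measure R, forall t, I01 t -> h t <= 1} ->
  \int[lebesgue_measure]_(t in @I01 R) h t <= 1.
Proof.
move=> mh h0 h1; rewrite /Rintegral.
have mI : measurable (@I01 R : set (measurableTypeR R)) by exact: measurable_itv.
have le1 : (\int[lebesgue_measure]_(t in @I01 R) (h t)%:E <= 1%E)%E.
  apply: (@le_trans _ _ (\int[lebesgue_measure]_(t in @I01 R) (cst 1 t)%:E)%E).
    apply: ae_ge0_le_integral => //.
    - by move=> t _; rewrite lee_fin.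
    - exact/measurable_EFinP.
    - exact/measurable_EFinP/measurable_cst.
  rewrite (integral_cst _ mI 1%:E) mul1e.
  rewrite [leLHS](lebesgue_measure_itv `[0%R, 1%R]) /=.
  by rewrite lte_fin ltr01 -EFinB subr0.
have : (0 <= \int[lebesgue_measure]_(t in @I01 R) (h t)%:E)%E.
  by apply: integral_ge0 => t _; rewrite lee_fin.
by move: le1; case: (\int[_]_(t in _) _)%E => [r| |] //=; rewrite lee_fin.
Qed.

(** For the unit vector of the complex line the identity reads
[1 = K * \int |f 0|^2], and the integral is at most 1. *)
Lemma universal_const_ge1 (K : R) : universal_const K -> 1 <= K.
Proof.
move=> /(_ _ _ bessel_unit_sequence)[f [fL f1 fG]].
have := fG 0%N 0%N; rewrite /inner /= /line_inner rmorph1 mulr1.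
move/(congr1 (@complex.Re R)); rewrite /cintegral01 /= mul0r subr0.
have -> : (fun t => complex.Re (f 0%N t * ((f 0%N t)^* )%R)) = (fun t => sqn (f 0%N t)).
  by apply/funext => t; rewrite -sqnE.
set J := Rintegral _ _ _ => K1.
have J0 : 0 <= J by apply: Rintegral_ge0 => t _; exact: sqn_ge0.
have J1 : J <= 1.
  apply: Rintegral01_le1.
  - have [[mRe mIm] _] := fL 0%N.
    by apply: measurable_funD; exact: measurable_funX.
  - by move=> t; exact: sqn_ge0.
  - have /Linfty_norm_le1/ae_lebesgue01 := f1 0%N.
    have FF := ae_filter_ringOfSetsType (@lebesgue_measure R).
    apply: (filterS (Filter := FF)) => t ft It; have := ft It.
    by rewrite normc_sqn -[leRHS]sqrtr1 ler_sqrt.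
rewrite leNgt; apply/negP => K_lt1.
have : 0 <= (1 - K) * J by rewrite mulr_ge0 // subr_ge0 ltW.
rewrite mulrBl mul1r -K1 subr_ge0 => Jge1.
have J_eq1 : J = 1 by apply/eqP; rewrite eq_le J1.
by move: K_lt1; rewrite K1 J_eq1 mulr1 ltxx.
Qed.

End ComplexLine.

(** * Representation of Bessel sequences *)

Section Representation.
Local Open Scope complex_scope.
Variable R : realType.
Local Notation C := R[i].

Variables (H : complexHilbert R) (x : nat -> H).
Hypothesis xB : bessel1 x.

(** Coordinates [2j] and [2j + 1] are the real and imaginary parts of [z j]. *)
Definition coord (z : nat -> C) (a : nat) : R :=
  if odd a then complex.Im (z a./2) else complex.Re (z a./2).

Lemma coord_even z j : coord z j.*2 = complex.Re (z j).
Proof. by rewrite /coord odd_double doubleK. Qed.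

Lemma coord_odd z j : coord z j.*2.+1 = complex.Im (z j).
Proof. by rewrite /coord /= odd_double /= uphalf_double. Qed.

Lemma coord_le1 z a : (forall j, sqn (z j) <= 1) -> `|coord z a| <= 1.
Proof.
move=> z1; rewrite -(@ler_pXn2r _ 2) ?nnegrE // expr1n real_normK ?num_real //.
apply: le_trans (z1 a./2); rewrite /coord /sqn.
by case: ifP => _; rewrite ?lerDl ?lerDr sqr_ge0.
Qed.

(** The list of approximating rows as an array: entries [j >= n], as well as rows
beyond the length of the list, are filled with 0, which lies in the disc. *)
Lemma gram_approximation_points n (e : R) : 0 < e ->
  exists kz : nat * (nat -> nat -> C),
  [/\ (0 < kz.1)%N, forall i j, sqn (kz.2 i j) <= 1 &
      forall j l, (j < n)%N -> (l < n)%N ->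
      sqn (inner (x j) (x l) -
        (average kz.1 (fun i => coord (kz.2 i) j.*2 * coord (kz.2 i) l.*2
                        + coord (kz.2 i) j.*2.+1 * coord (kz.2 i) l.*2.+1) +i*
         average kz.1 (fun i => coord (kz.2 i) j.*2.+1 * coord (kz.2 i) l.*2
                        - coord (kz.2 i) j.*2 * coord (kz.2 i) l.*2.+1))) <= e].
Proof.
move=> e0; have [s [s0 sD sG]] := gram_approximation xB n e0.
pose z i j := if insub j is Some j' then (nth 0 s i) 0 j' else 0 : C.
exists (size s, z); split => //= [i j|j l jn ln].
  rewrite /z; case: insubP => [j' _ _|_]; last by rewrite sqn0.
  have [si|si] := ltnP i (size s); first exact: (sD _ (mem_nth 0 si)).
  by rewrite nth_default // mxE sqn0.
have := sG (Ordinal jn) (Ordinal ln).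
rewrite /= (big_nth 0) big_mkord.
apply: le_trans; rewrite le_eqVlt; apply/orP; left; apply/eqP.
congr (sqn (_ - _)); rewrite /average.
have zE (i : 'I_(size s)) l' (l'n : (l' < n)%N) :
    z i l' = (nth 0 s i) 0 (Ordinal l'n) by rewrite /z insubT.
have -> : (size s)%:R^-1 = ((size s)%:R^-1 : R)%:C by rewrite fmorphV rmorph_nat.
apply/eqP; rewrite eq_complex ReZ ImZ !raddf_sum /=.
by apply/andP; split; apply/eqP; congr (_ * _); apply: eq_bigr => i _;
  rewrite !coord_even !coord_odd -!zE; case: (z i j) (z i l) => [a b] [c d] /=; ring.
Qed.

Lemma gram_representation : exists f : nat -> R -> C, gram_rep x f 1.
Proof.
(* The n-th array handles the first n vectors with precision 1 / (n + 1). *)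
have e0 n : 0 < n.+1%:R^-1 :> R by rewrite invr_gt0 ltr0n.
have [kz kzP] := choice (fun n => gram_approximation_points n (e0 n)).
pose k n := (kz n).1; pose z n := (kz n).2.
have k0 n : (0 < k n)%N by have [] := kzP n.
have z1 n i j : sqn (z n i j) <= 1 by have [_ + _] := kzP n; apply.
pose p n i := coord (z n i).
have p1 n i a : `|p n i a| <= 1 by exact: coord_le1.
have [g [mg g1 gp gI]] := limit_law k0 p1.
pose f j t := g j.*2 t +i* g j.*2.+1 t.
have f1 j t : 0 <= t < 1 -> Normc.normc (f j t) <= 1.
  move=> t01; rewrite normc_sqn; apply/ler_addgt0Pr => e e_gt0.
  have e20 : 0 < e / 2 by rewrite divr_gt0.
  have [n [i [ik gz]]] := gp t j.*2.+2 _ t01 e20.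
  have := gz j.*2 (ltnW (leqnn _)); have := gz j.*2.+1 (leqnn _).
  rewrite /p coord_even coord_odd => im_le re_le.
  have e1_ge0 : 0 <= 1 + e by rewrite addr_ge0 // ltW.
  rewrite -[leRHS](ger0_norm e1_ge0) -sqrtr_sqr ler_wsqrtr //.
  rewrite -[f j t](subrK (z n i j)) addrC; apply: sqn_add_le => //.
  - exact: ltW.
  - by rewrite expr1n.
  move: re_le im_le; rewrite /f; case: (z n i j) => c d /=.
  by rewrite /sqn /= !ler_norml => /andP[? ?] /andP[? ?]; nra.
have fN j : (Linfty_norm (f j) <= 1)%E.
  (* The end point 1 lies in no cell of the subdivision, and is negligible. *)
  apply/Linfty_norm_le1; exists (~` `[0, 1[); split.
  - by apply: measurableC; exact: measurable_itv.
  - rewrite -[LHS]/(@lebesgue_measure R (~` `[0, 1[ `&` @I01 R)).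
    rewrite (_ : _ `&` _ = [set 1]); first exact: lebesgue_measure_set1.
    apply/seteqP; split => t /=; rewrite /I01 /= !in_itv /=.
      by move=> [/negP + /andP[t0 t1]]; rewrite t0 /= -leNgt => t1'; apply/eqP; rewrite eq_le t1.
    by move=> ->; rewrite ltxx ler01 lexx.
  - move=> t /= nf; rewrite in_itv /= => t01; apply: nf; exact: f1.
exists f; split.
- move=> j; split; last exact: le_lt_trans (fN j) (ltry _).
  by split; exact: mg.
- exact: fN.
- move=> j l; rewrite mul1r.
  have mI : measurable (`[0, 1] : set (measurableTypeR R)) by exact: measurable_itv.
  have ggI a b : (@lebesgue_measure R).-integrable `[0, 1]
      (EFin \o (fun t => g a t * g b t)).
    apply: (bounded_integrable01 (b := false) (M := 1)) => [|t _].
      exact: measurable_funM.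
    by rewrite normrM mulr_ile1.
  pose J a b := \int[lebesgue_measure]_(t in `[0, 1]) (g a t * g b t).
  have -> : cintegral01 (fun t => f j t * ((f l t)^* )%R) =
      (J j.*2 l.*2 + J j.*2.+1 l.*2.+1) +i* (J j.*2.+1 l.*2 - J j.*2 l.*2.+1).
    rewrite /cintegral01 /J /I01 -(RintegralD mI) // -(RintegralB mI) //.
    by congr (_ +i* _); apply: eq_Rintegral => t _; rewrite /f /=; ring.
  set G := inner _ _.
  have close e : 0 < e ->
      `|complex.Re G - (J j.*2 l.*2 + J j.*2.+1 l.*2.+1)| < e /\
      `|complex.Im G - (J j.*2.+1 l.*2 - J j.*2 l.*2.+1)| < e.
    move=> e_gt0; pose d := e / 4.
    have d0 : 0 < d by rewrite divr_gt0.
    pose M := maxn j l; pose N := maxn M.+1 (Num.truncn (d ^+ 2)^-1).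
    have [n Nn nP] := gI M.*2.+2 N d d0.
    have jM : (j <= M)%N := leq_maxl j l.
    have lM : (l <= M)%N := leq_maxr j l.
    have Mn : (M < n)%N := leq_trans (leq_maxl _ _) Nn.
    have nd : n.+1%:R^-1 <= d ^+ 2.
      rewrite invf_ple ?posrE ?exprn_gt0 ?ltr0n //.
      apply/ltW/(lt_le_trans (truncnS_gt _)); rewrite ler_nat ltnS.
      exact: leq_trans (leq_maxr _ _) Nn.
    have [_ _ /(_ j l (leq_ltn_trans jM Mn) (leq_ltn_trans lM Mn))] := kzP n.
    move/le_trans => /(_ _ nd); rewrite -/G -/(k n) -/(z n) averageD -averageB.
    have ev a : (a <= M)%N -> (a.*2 < M.*2.+2)%N.
      by move=> aM; rewrite ltnS leqW // leq_double.
    have od a : (a <= M)%N -> (a.*2.+1 < M.*2.+2)%N.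
      by move=> aM; rewrite !ltnS leq_double.
    have := nP _ _ (ev _ jM) (ev _ lM); have := nP _ _ (od _ jM) (od _ lM).
    have := nP _ _ (od _ jM) (ev _ lM); have := nP _ _ (ev _ jM) (od _ lM).
    rewrite -!/(J _ _).
    rewrite /p; move: (average _ _) (average _ _) (average _ _) (average _ _).
    move=> A1 A2 A3 A4 h4 h3 h2 h1 /(sqn_le_ReIm (ltW d0)) /= [].
    case: (G) => G1 G2 /=; move: h1 h2 h3 h4; rewrite /d !ler_norml !ltr_norml.
    move=> /andP[? ?] /andP[? ?] /andP[? ?] /andP[? ?] /andP[? ?] /andP[? ?].
    by split; apply/andP; split; lra.
  apply/eqP; rewrite eq_complex /=; apply/andP; split; rewrite -subr_eq0;
    by apply/eqP/eq0_lt => e /close[].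
Qed.

End Representation.

Theorem theorem1p1 (R : realType) :
  (forall (H : complexHilbert R) (x : nat -> H), bessel1 x ->
     exists (f : nat -> R -> R[i]) (K : R), 0 < K /\ gram_rep x f K)
  /\ universal_const (1 : R)
  /\ (forall K : R, universal_const K -> 1 <= K).
Proof.
split=> [H x xB|].
  by have [f fx] := gram_representation xB; exists f, 1.
split=> [H x xB|K]; last exact: universal_const_ge1.
exact: gram_representation.
Qed.
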